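(* (1) Let $C_1:=\{h(x,x^2,1): x\in\mathbb{R},\ h\in\mathbb{R}\}\subset\mathbb{R}^3$ (parabolic cone). Then $\dim_F(C_1)=1$. (2) There is an open interval $I_2\ni 0$ such that, with $C_2:=\{h(x+x^3,x^2,1): x\in I_2,\ h\in\mathbb{R}\}\subset\mathbb{R}^3$ (perturbed parabolic cone), $\dim_F(C_2)=1$ (and the same holds for every smaller open interval containing $0$). (3) Let $D_1:=\{(x,x^2,h): x\in\mathbb{R},\ h\in\mathbb{R}\}\subset\mathbb{R}^3$ (parabolic cylinder). Then $\dim_F(D_1)=1$.
   Context: For a Borel set $A\subset\mathbb{R}^n$, $\mathcal{M}(A)$ denotes the set of nonzero finite (positive) Borel measures on $\mathbb{R}^n$ supported on $A$; $\widehat{\mu}(\xi)=\int e^{-2\pi i x\cdot\xi}\,d\mu(x)$; and $\dim_F(A)$ is the supremum of $s\in[0,n]$ such that some $\mu\in\mathcal{M}(A)$ satisfies $\sup_{\xi}|\xi|^{s/2}|\widehat{\mu}(\xi)|<\infty$. *)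

(* Defs.v *)
(* R^3 is modelled as the product (R * R) * R with
   the product sigma-algebra of the Borel sigma-algebras on R (= Borel sets of R^3). *)
From HB Require Import structures.
From mathcomp Require Import all_boot all_order all_algebra.
From mathcomp Require Import all_classical all_reals all_analysis.
Import numFieldNormedType.Exports.
Set Implicit Arguments. Unset Strict Implicit. Unset Printing Implicit Defensive.
Import Order.TTheory GRing.Theory Num.Theory.
Local Open Scope classical_set_scope.
Local Open Scope ring_scope.

Section FourierDim.
Variable R : realType.

Local Notation R3 := ((R * R) * R)%type.

Definition pt (a b c : R) : R3 := ((a, b), c).
Definition c1 (p : R3) : R := p.1.1.
Definition c2 (p : R3) : R := p.1.2.
Definition c3 (p : R3) : R := p.2.

Definition dot3 (x y : R3) : R := c1 x * c1 y + c2 x * c2 y + c3 x * c3 y.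
Definition norm3 (x : R3) : R := Num.sqrt (dot3 x x).

(* closed support condition: spt mu is contained in A, i.e. every point all of whose
   open neighbourhoods have positive mu-measure lies in A *)
Definition supported_on (mu : {measure set R3 -> \bar R}) (A : set R3) : Prop :=
  forall x : R3, (forall U : set R3, open U -> U x -> (0 < mu U)%E) -> A x.

Definition MA (A : set R3) (mu : {measure set R3 -> \bar R}) : Prop :=
  (mu setT != 0)%E /\ (mu setT < +oo)%E /\ supported_on mu A.

(* Fourier transform  \hat mu (xi) = \int e^{-2 pi i x.xi} dmu(x),
   given by its real and imaginary parts *)
Definition ft_re (mu : {measure set R3 -> \bar R}) (xi : R3) : R :=
  Rintegral mu setT (fun x => cos (2 * pi * dot3 x xi)).
Definition ft_im (mu : {measure set R3 -> \bar R}) (xi : R3) : R :=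
  - Rintegral mu setT (fun x => sin (2 * pi * dot3 x xi)).
Definition ft_abs (mu : {measure set R3 -> \bar R}) (xi : R3) : R :=
  Num.sqrt (ft_re mu xi ^+ 2 + ft_im mu xi ^+ 2).

Definition fourier_dim (A : set R3) : R :=
  sup [set s : R | 0 <= s <= 3 /\
    exists mu : {measure set R3 -> \bar R}, MA A mu /\
      exists C : R, forall xi : R3, norm3 xi `^ (s / 2) * ft_abs mu xi <= C].

Definition parabolic_cone : set R3 :=
  [set p | exists x h : R, p = pt (h * x) (h * x ^+ 2) h].
Definition perturbed_cone (a b : R) : set R3 :=
  [set p | exists x h : R, a < x < b /\ p = pt (h * (x + x ^+ 3)) (h * x ^+ 2) h].
Definition parabolic_cylinder : set R3 :=
  [set p | exists x h : R, p = pt x (x ^+ 2) h].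

End FourierDim.

(* Main.v *)
(* Upper bound: let [mu] be supported on one of the surfaces and suppose that its
   Fourier transform decays like [|xi|^(-s/2)] with [s > 1]. Integrating the Fejer
   sum [sum_(k,l < N) cos (2 pi (k - l) (n . x - c))], which is nonnegative and of
   size [N^2] on the slab [|n . x - c| <= 1/(8N)], bounds the mass of that slab by
   [O(N^(-s/2))] (for [s < 2]). The surfaces are developable: a tangent plane touches
   along a whole ruling, so a strip of width [1/sqrt N] of a bounded part of the
   surface lies in one such slab. Hence [O(sqrt N)] slabs cover the bounded part, its
   mass is [O(N^((1-s)/2))], and [mu] vanishes.

   Lower bound: push the uniform measure on a small square forward by the
   parametrization. For each frequency the phase either has a large first or second
   derivative along the curve, or is linear with large slope along the rulings;
   van der Corput's estimate gives decay [|xi|^(-1/2)] in each case. *)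
Require Import Defs.
From HB Require Import structures.
From mathcomp Require Import all_boot all_order all_algebra.
From mathcomp Require Import all_classical all_reals all_analysis.
From mathcomp Require Import measurable_realfun ring lra.
Import numFieldNormedType.Exports.
Import Order.TTheory GRing.Theory Num.Theory.
Set Implicit Arguments.
Unset Strict Implicit.
Unset Printing Implicit Defensive.
Local Open Scope classical_set_scope.
Local Open Scope ring_scope.

(** * Borel sets of three-space and complements of supports *)

Section borel_R3.
Variable R : realType.
Local Notation R3 := ((R * R) * R)%type.

(* Junk value: codes that are not in the image of [pickle] give the empty box. *)
Definition rat_box (k : nat) : set R3 :=
  if @unpickle (rat * rat * rat * rat * rat * rat)%type k is
    Some (p1, r1, p2, r2, p3, r3)
  then (ball (ratr p1 : R) (ratr r1) `*` ball (ratr p2 : R) (ratr r2)) `*`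
    ball (ratr p3 : R) (ratr r3)
  else set0.

Lemma measurable_rat_box k : measurable (rat_box k).
Proof.
rewrite /rat_box; case: unpickle => [[[[[[p1 r1] p2] r2] p3] r3]|//].
by apply: measurableX; first apply: measurableX; exact: measurable_ball.
Qed.

Lemma rat_box_basis (U : set R3) x : open U -> U x ->
  exists2 k, rat_box k x & rat_box k `<=` U.
Proof.
case: x => [[x1 x2] x3] oU Ux.
have : nbhs (x1, x2, x3) U by exact/open_nbhs_nbhs.
move=> -[[/= P Q] [/= [[/= P1 P2] [/= P1x P2x] PP] Qx] PQ].
have rat_ball (A : set R) (a : R) : nbhs a A ->
    exists c r, ball (@ratr R c) (ratr r) a /\ ball (@ratr R c) (ratr r) `<=` A.
  move=> aA.
  have [c [r [/set_mem ca cA]]] := open_subball_rat (@open_interior _ A)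
    (mem_set (aA : A^° a)).
  by exists c, r; split => //; apply: subset_trans cA _; exact: interior_subset.
have [p1 [r1 [x1B B1]]] := rat_ball _ _ P1x.
have [p2 [r2 [x2B B2]]] := rat_ball _ _ P2x.
have [p3 [r3 [x3B B3]]] := rat_ball _ _ Qx.
exists (pickle (p1, r1, p2, r2, p3, r3)); rewrite /rat_box pickleK//.
move=> [[y1 y2] y3] [[/= /B1 y1P /B2 y2P] /B3 y3Q].
by apply: PQ; split => //=; apply: PP.
Qed.

(** Links the topology of [R3] to its product sigma-algebra: an open set is the union of the
    countably many rational boxes that it contains. *)
Lemma open_measurable3 (U : set R3) : open U -> measurable U.
Proof.
move=> oU.
rewrite (_ : U = \bigcup_(k in [set k | rat_box k `<=` U]) rat_box k).
  by apply: bigcup_measurable => k _; exact: measurable_rat_box.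
apply/seteqP; split => [x /(rat_box_basis oU)[k kx kU]|x [k /= kU /kU//]].
by exists k.
Qed.

(** Every point off [A] has a null open neighbourhood, hence lies in a null rational box, and there
    are only countably many boxes. The set [A] may be nonmeasurable, so the conclusion is
    negligibility. *)
Lemma negligible_setC_supported (mu : {measure set R3 -> \bar R}) (A : set R3) :
  supported_on mu A -> mu.-negligible (~` A).
Proof.
move=> muA; pose F k := if mu (rat_box k) == 0%E then rat_box k else set0.
apply: (@negligibleS _ _ _ _ (\bigcup_k F k)); last first.
  apply: negligible_bigcup => k; rewrite /F; case: ifPn => [/eqP k0|_].
    by apply/negligibleP => //; exact: measurable_rat_box.
  exact: negligible_set0.
move=> x Ax; have [U [oU Ux muU]] : exists U, [/\ open U, U x & mu U = 0%E].
  apply: contrapT => nU; apply: Ax; apply: muA => U oU Ux.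
  rewrite lt0e measure_ge0 andbT; apply/eqP => U0.
  by apply: nU; exists U.
have [k kx kU] := rat_box_basis oU Ux.
exists k => //; rewrite /F ifT//; apply/eqP/eqP; rewrite -measure_le0 -muU.
by rewrite le_measure ?inE//; [exact: measurable_rat_box|exact: open_measurable3].
Qed.

End borel_R3.

(** * Fejer sums and sums of negative powers *)

Section fejer.
Variable R : realType.
Implicit Types (a s t y : R) (e : nat -> R).

(** Concavity of the power, obtained from Young's inequality with exponents [1 / a] and
    [1 / (1 - a)]. *)
Lemma powR_le_tangent a y : 0 < a < 1 -> 0 <= y -> y `^ a <= 1 - a + a * y.
Proof.
move=> /andP[a0 a1] y0.
have := @conjugate_powR R (y `^ a) 1 a^-1 (1 - a)^-1.
rewrite !invr_gt0 !invrK powR1 -powRrM divff ?gt_eqF// powRr1// !mulr1 mul1r.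
rewrite powR_ge0 a0 subr_gt0 a1 ler01 => /(_ isT isT isT isT); lra.
Qed.

(** Comparison with the integral of [x^(-s)] over [[0, N]], done by induction: the increment is
    controlled by the tangent inequality with exponent [1 - s] at [N / (N + 1)]. *)
Lemma sum_powRN_le (N : nat) s : 0 < s < 1 ->
  \sum_(1 <= j < N.+1) j%:R `^ (- s) <= N%:R `^ (1 - s) / (1 - s) :> R.
Proof.
move=> /andP[s0 s1]; have s1' : 0 < 1 - s by lra.
elim: N => [|N ih].
  by rewrite big_geq// divr_ge0// ?powR_ge0// ltW.
rewrite big_nat_recr//= (le_trans (lerD ih (lexx _)))//.
set b : R := N.+1%:R; have b0 : 0 < b by rewrite ltr0n.
have Nb : N%:R = b * (N%:R / b) by rewrite mulrC divfK// gt_eqF.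
rewrite [in leLHS]Nb powRM ?divr_ge0 ?ler0n//.
have s11 : 0 < 1 - s < 1 by rewrite s1' ltrBlDr ltrDl.
have Nb0 : 0 <= N%:R / b by rewrite divr_ge0// ltW.
have /(ler_wpM2l (powR_ge0 b (1 - s))) := powR_le_tangent s11 Nb0.
have -> : b `^ (- s) = b `^ (1 - s) / b.
  rewrite addrC powRD; last by rewrite (gt_eqF b0) implybT.
  by rewrite powRr1 ?mulfK ?gt_eqF// ltW.
have -> : N%:R / b = 1 - b^-1.
  by rewrite -[X in X / b](addrK 1 N%:R) natr1 mulrBl divff ?gt_eqF// mul1r.
set B := b `^ _; set Y := _ `^ (1 - s) => H.
rewrite -lerBrDr ler_pdivrMr// mulrBl divfK ?gt_eqF//.
by apply: le_trans H _; rewrite le_eqVlt; apply/orP; left; apply/eqP; ring.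
Qed.

(* With truncated subtraction, [k - l + (l - k)] is the distance of [k] and [l]. *)
Lemma sum_absdiff_le (N k : nat) e : (forall j, 0 <= e j) -> (k < N)%N ->
  \sum_(0 <= l < N) e (k - l + (l - k))%N <= 2 * \sum_(0 <= j < N) e j.
Proof.
move=> e0 kN.
have sub m n : (n <= N)%N -> \sum_(m <= j < n) e j <= \sum_(0 <= j < N) e j.
  move=> nN; have [mn|nm] := leqP m n; last first.
    by rewrite big_geq ?sumr_ge0// ltnW.
  rewrite [leRHS](big_cat_nat (n := n))//= [X in _ <= X + _](big_cat_nat (n := m))//=.
  by rewrite -addrA addrCA lerDl addr_ge0// sumr_ge0.
(* Cut at [l = k]: on the left the distances are [1, ..., k], on the right [0, ..., N - k - 1], each
   taken once. *)
rewrite (big_cat_nat (n := k))//=; last exact: ltnW.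
rewrite mulr_natl mulr2n lerD//.
  rewrite big_nat_rev/= add0n (_ : \sum_(_ <= _ < _) _ = \sum_(1 <= j < k.+1) e j).
    exact: sub.
  rewrite big_add1/=; apply: eq_big_nat => i /andP[_ ik].
  by rewrite subKn// (eqP (_ : k - i.+1 - k == 0)%N) ?addn0// subn_eq0 leq_subr.
rewrite -{1}[k]add0n big_addn (eq_big_nat _ _ (F2 := e)); last first.
  by move=> i _; rewrite addnK (eqP (_ : k - (i + k) == 0)%N)// subn_eq0 leq_addl.
by apply: sub; rewrite leq_subr.
Qed.

(** The double sum is [|sum_k exp(i k y)|^2], hence nonnegative for every [y]. *)
Lemma sum_cosB_sqr (N : nat) y :
  \sum_(0 <= k < N) \sum_(0 <= l < N) cos ((k%:R - l%:R) * y) =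
  (\sum_(0 <= k < N) cos (k%:R * y)) ^+ 2 +
  (\sum_(0 <= k < N) sin (k%:R * y)) ^+ 2 :> R.
Proof.
rewrite !expr2 !mulr_suml -big_split/=; apply: eq_bigr => k _.
rewrite !mulr_sumr -big_split/=; apply: eq_bigr => l _.
by rewrite mulrBl cosB.
Qed.

Lemma cos1_le t : `|t| <= 1 -> cos 1 <= cos t :> R.
Proof.
move=> t1; rewrite -(cos_norm t) leNgt; apply/negP; have := pi_ge2 R => p2.
rewrite ltr_cos ?in_itv/= ?normr_ge0/= ?ler01/=; first lra.
- lra.
- lra.
Qed.

(** All the angles [k y] stay in [[-1, 1]], where the cosine is at least [cos 1]; the square of the
    sine sum is dropped. *)
Lemma sum_cosB_ge (N : nat) y : `|N%:R * y| <= 1 ->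
  (N%:R * cos 1) ^+ 2 <=
  \sum_(0 <= k < N) \sum_(0 <= l < N) cos ((k%:R - l%:R) * y) :> R.
Proof.
move=> Ny; rewrite sum_cosB_sqr -[leLHS]addr0 lerD ?sqr_ge0//.
have cosk k : (0 <= k < N)%N -> cos 1 <= cos (k%:R * y).
  move=> /andP[_ kN]; rewrite cos1_le// (le_trans _ Ny)//.
  by rewrite !normrM ler_wpM2r ?normr_ge0// !ger0_norm ?ler0n// ler_nat ltnW.
have le_sum : N%:R * cos 1 <= \sum_(0 <= k < N) cos (k%:R * y).
  rewrite -[X in X%:R]subn0 mulr_natl -sumr_const_nat.
  exact: ler_sum_nat.
have N0 : 0 <= N%:R * cos 1 :> R by rewrite mulr_ge0 ?ler0n// ltW ?cos1_gt0.
by rewrite lerXn2r ?nnegrE// (le_trans N0).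
Qed.

End fejer.

(** * Mass of a slab under Fourier decay *)

Section slab.
Variable R : realType.
Local Notation R3 := ((R * R) * R)%type.

Lemma bounded_finite_integrable d (T : measurableType d)
    (mu : {measure set T -> \bar R}) (f : T -> R) (B : R) :
  (mu setT < +oo)%E -> measurable_fun setT f -> (forall x, `|f x| <= B) ->
  mu.-integrable setT (EFin \o f).
Proof.
move=> muT mf fB; apply: measurable_bounded_integrable => //.
by exists B; split; [exact: num_real|move=> M BM x _; exact: le_trans (fB x) (ltW BM)].
Qed.

Lemma integrable_sum_EFin d (T : measurableType d)
    (mu : {measure set T -> \bar R}) (I : Type) (s : seq I) (f : I -> T -> R) :
  (forall i, mu.-integrable setT (EFin \o f i)) ->
  mu.-integrable setT (EFin \o (fun x => \sum_(i <- s) f i x)).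
Proof.
move=> fi; rewrite (_ : _ \o _ = fun x => (\sum_(i <- s) (f i x)%:E)%E).
  by apply: integrable_sum => // i _; exact: fi.
by apply/funext => x; rewrite /= sumEFin.
Qed.

Lemma Rintegral_sum d (T : measurableType d) (mu : {measure set T -> \bar R})
    (I : Type) (s : seq I) (f : I -> T -> R) :
  (forall i, mu.-integrable setT (EFin \o f i)) ->
  Rintegral mu setT (fun x => \sum_(i <- s) f i x) =
  \sum_(i <- s) Rintegral mu setT (f i).
Proof.
move=> fi; rewrite /Rintegral.
under eq_integral do rewrite -sumEFin.
by rewrite integral_sum// -sum_fine// => i _; exact: (integrable_fin_num _ (fi i)).
Qed.

Lemma measurable_c1 : measurable_fun setT (@c1 R).
Proof. exact: (measurableT_comp measurable_fst measurable_fst). Qed.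

Lemma measurable_c2 : measurable_fun setT (@c2 R).
Proof. exact: (measurableT_comp measurable_snd measurable_fst). Qed.

Lemma measurable_c3 : measurable_fun setT (@c3 R).
Proof. exact: measurable_snd. Qed.

Lemma measurable_dot3 (xi : R3) : measurable_fun setT (fun x => dot3 x xi).
Proof.
by apply: measurable_funD; first apply: measurable_funD;
  apply: measurable_funM => //; [exact: measurable_c1|exact: measurable_c2|
  exact: measurable_c3].
Qed.

Lemma measurable_cos_dot3 (xi : R3) (a b : R) :
  measurable_fun setT (fun x => cos (a * dot3 x xi - b)).
Proof.
apply: (measurableT_comp (continuous_measurable_fun (@continuous_cos R))).
apply: measurable_funB => //.
by apply: measurable_funM => //; exact: measurable_dot3.
Qed.

Lemma measurable_sin_dot3 (xi : R3) (a : R) :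
  measurable_fun setT (fun x => sin (a * dot3 x xi)).
Proof.
apply: (measurableT_comp (continuous_measurable_fun (@continuous_sin R))).
by apply: measurable_funM => //; exact: measurable_dot3.
Qed.

Definition slab (n : R3) (c r : R) : set R3 := [set x | `|dot3 x n - c| <= r].

Lemma measurable_slab n c r : measurable (slab n c r).
Proof.
have mf : measurable_fun setT (fun x => `|dot3 x n - c|).
  apply: measurableT_comp => //; apply: measurable_funB => //.
  exact: measurable_dot3.
by have := mf measurableT _ (measurable_itv `]-oo, r]); rewrite setTI;
  congr measurable; apply/seteqP; split => x; rewrite /slab /= in_itv.
Qed.

Variable mu : {measure set R3 -> \bar R}.
Hypothesis muT : (mu setT < +oo)%E.

Lemma normr_ft_re_le xi : `|ft_re mu xi| <= ft_abs mu xi.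
Proof. by rewrite /ft_abs -sqrtr_sqr ler_wsqrtr// lerDl sqr_ge0. Qed.

Lemma normr_ft_im_le xi : `|ft_im mu xi| <= ft_abs mu xi.
Proof. by rewrite /ft_abs -sqrtr_sqr ler_wsqrtr// lerDr sqr_ge0. Qed.

Lemma integrable_cos_dot3 xi (a b : R) :
  mu.-integrable setT (EFin \o (fun x => cos (a * dot3 x xi - b))).
Proof.
apply: (bounded_finite_integrable muT (measurable_cos_dot3 _ _ _) (B := 1)).
by move=> x; exact: cos_max.
Qed.

(** A phase shift mixes the real and the imaginary part of the transform; estimating each by
    [ft_abs] costs the factor 2. *)
Lemma normr_Rintegral_cos_le xi (b : R) :
  `|Rintegral mu setT (fun x => cos (2 * pi * dot3 x xi - b))| <=
  2 * ft_abs mu xi.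
Proof.
have ic : mu.-integrable setT (EFin \o (fun x => cos (2 * pi * dot3 x xi))).
  by have := integrable_cos_dot3 xi (2 * pi) 0; under eq_fun do rewrite subr0.
have is_ : mu.-integrable setT (EFin \o (fun x => sin (2 * pi * dot3 x xi))).
  apply: (bounded_finite_integrable muT (measurable_sin_dot3 _ _) (B := 1)).
  by move=> x; exact: sin_max.
under eq_Rintegral do rewrite cosB [X in X + _]mulrC [X in _ + X]mulrC.
rewrite RintegralD//; [|exact: (integrableZl _ (cos b) ic)|
  exact: (integrableZl _ (sin b) is_)].
rewrite !RintegralZl// (le_trans (ler_normD _ _))// !normrM.
have := ler_pM (normr_ge0 _) (normr_ge0 _) (cos_max b) (normr_ft_re_le xi).
have := ler_pM (normr_ge0 _) (normr_ge0 _) (sin_max b) (normr_ft_im_le xi).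
rewrite /ft_im normrN /ft_re; lra.
Qed.

(** The Fejer sum is integrated against [mu]. Each diagonal term contributes the total mass, the
    term [(k, l)] a transform at frequency [(k - l) n] of size [O(|k - l|^(-s))]. The total
    [O(N^(2 - s))] is compared with the lower bound [(N cos 1)^2] on the slab. Here [s] is half of
    the dimension exponent. *)
Lemma measure_slab_le n c (s C : R) (N : nat) : 0 < s < 1 -> 0 <= C ->
  1 <= c2 n -> (0 < N)%N ->
  (forall xi, 1 <= norm3 xi -> norm3 xi `^ s * ft_abs mu xi <= C) ->
  fine (mu (slab n c (8 * N%:R)^-1)) <=
  2 * (fine (mu setT) + 2 * C / (1 - s)) / cos 1 ^+ 2 * N%:R `^ (- s).
Proof.
move=> s01 C0 n1 N0 decay; have /andP[s0 s1] := s01.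
set S := slab _ _ _; set m := fine (mu setT).
have m0 : 0 <= m by rewrite fine_ge0.
have Npos : 0 < N%:R :> R by rewrite ltr0n.
pose y (x : R3) := 2 * pi * dot3 x n - 2 * pi * c.
pose term (k l : nat) (x : R3) := cos ((k%:R - l%:R) * y x).
pose e (j : nat) : R := if j is 0%N then m else 2 * C * j%:R `^ (- s).
have e0 j : 0 <= e j.
  by case: j => [|j]//=; rewrite mulr_ge0 ?powR_ge0// mulr_ge0.
pose sc (r : R) := pt (r * c1 n) (r * c2 n) (r * c3 n).
have termE k l : term k l = fun x => cos (2 * pi * dot3 x (sc (k%:R - l%:R)) -
                                          2 * pi * c * (k%:R - l%:R)).
  apply/funext => x.
  by rewrite /term /y /dot3 /sc /c1 /c2 /c3 /=; congr cos; ring.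
(* Since the second coordinate of [n] is at least 1, the frequency [r n] has norm at least [|r|]. *)
have norm_sc r : `|r| <= norm3 (sc r).
  rewrite /norm3 -sqrtr_sqr ler_wsqrtr// /dot3 /sc /= /c1 /c2 /c3 /=.
  move: n1; rewrite /c2 => n1; have b2 : 1 <= n.1.2 * n.1.2 by nra.
  have := ler_wpM2l (sqr_ge0 r) b2.
  have := sqr_ge0 (r * n.1.1); have := sqr_ge0 (r * n.2); lra.
have iterm k l : mu.-integrable setT (EFin \o term k l).
  by rewrite termE; exact: integrable_cos_dot3.
have term_le k l : Rintegral mu setT (term k l) <= e (k - l + (l - k))%N.
  have absE : (k - l + (l - k))%:R = `|k%:R - l%:R| :> R.
    have [kl|lk] := leqP k l.
      rewrite ler0_norm ?subr_le0 ?ler_nat// opprB -natrB//.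
      by move: kl; rewrite -subn_eq0 => /eqP ->.
    rewrite ger0_norm ?subr_ge0 ?ler_nat 1?ltnW// -natrB 1?ltnW//.
    by move/ltnW: lk; rewrite -subn_eq0 => /eqP ->; rewrite addn0.
  case dE : (k - l + (l - k))%N absE => [|d] absE /=.
    rewrite (_ : term k l = cst 1) ?Rintegral_cst ?mul1r//.
    apply/funext => x; rewrite /term.
    by move/esym/eqP: absE; rewrite normr_eq0 => /eqP ->; rewrite mul0r cos0.
  rewrite termE (le_trans (ler_norm _))// (le_trans (normr_Rintegral_cos_le _ _))//.
  rewrite -mulrA ler_pM2l//; set r := k%:R - l%:R in absE *.
  have r1 : 1 <= `|r| by rewrite -absE ler1n.
  rewrite powRN absE ler_pdivlMr ?powR_gt0 ?(lt_le_trans _ r1)// mulrC.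
  apply: le_trans (decay (sc r) (le_trans r1 (norm_sc r))).
  rewrite ler_wpM2r ?sqrtr_ge0// ge0_ler_powR ?nnegrE ?norm_sc//; first exact: ltW.
  exact: sqrtr_ge0.
have sum_e : \sum_(0 <= j < N) e j <= m + 2 * C / (1 - s) * N%:R `^ (1 - s).
  rewrite big_ltn//= lerD2l.
  rewrite (eq_big_nat _ _ (F2 := fun j => 2 * C * j%:R `^ (- s))); last by case.
  rewrite -mulr_sumr -!mulrA ler_pM2l// ler_wpM2l// mulrC.
  apply: le_trans (sum_powRN_le N s01).
  by rewrite [leRHS]big_nat_recr//= lerDl powR_ge0.
pose D x := \sum_(0 <= k < N) \sum_(0 <= l < N) term k l x.
have iD : mu.-integrable setT (EFin \o D).
  by apply: integrable_sum_EFin => k; exact: integrable_sum_EFin.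
have D_le : Rintegral mu setT D <=
    N%:R * (2 * (m + 2 * C / (1 - s) * N%:R `^ (1 - s))).
  rewrite Rintegral_sum; last by move=> k; exact: integrable_sum_EFin.
  rewrite -[X in X%:R * _]subn0 mulr_natl -sumr_const_nat.
  apply: ler_sum_nat => k /andP[_ kN]; rewrite Rintegral_sum//.
  apply: le_trans (_ : 2 * \sum_(0 <= j < N) e j <= _); last by rewrite ler_pM2l.
  apply: le_trans (sum_absdiff_le e0 kN).
  by apply: ler_sum => l _; exact: term_le.
have S_le : (N%:R * cos 1) ^+ 2 * fine (mu S) <= Rintegral mu setT D.
  have mS : measurable S by exact: measurable_slab.
  have iS : mu.-integrable setT (EFin \o (\1_S : R3 -> R)).
    apply: (bounded_finite_integrable muT (B := 1)) => // x.
    by rewrite indicE; case: (_ \in _); rewrite ?normr0 ?normr1 ?ler01.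
  have -> : fine (mu S) = Rintegral mu setT (\1_S : R3 -> R).
    by rewrite /Rintegral integral_indic// setIT.
  rewrite -RintegralZl//; apply: le_Rintegral => //; first exact: (integrableZl _ _ iS).
  move=> x _ /=; have [Sx|nSx] := boolP (x \in S); last first.
    by rewrite mulr0 /D /term sum_cosB_sqr addr_ge0// sqr_ge0.
  rewrite mulr1; apply: sum_cosB_ge.
  move/set_mem: Sx; rewrite /S /slab /= /y -mulrBr !normrM.
  rewrite !(ger0_norm (pi_ge0 R)) (ger0_norm (ler0n R N)) ger0_norm// => Sx.
  (* With [pi <= 4], the slab radius [1 / (8 N)] gives [N |y x| <= 2 pi / 8 <= 1]. *)
  have pi4 : pi <= 4 :> R by have := pihalf_lt2 R; lra.
  apply: le_trans (_ : N%:R * (2 * 4 * (8 * N%:R)^-1) <= _).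
    rewrite ler_pM2l// ler_pM// ?mulr_ge0 ?pi_ge0// ler_pM2l//.
  by rewrite le_eqVlt; apply/orP; left; apply/eqP; field; rewrite gt_eqF.
have c0 := cos1_gt0 R.
have Ns1 : 1 <= N%:R `^ (1 - s) :> R.
  by rewrite -[leLHS](powRr0 N%:R) ler_powR ?ler1n// subr_ge0 ltW.
have -> : N%:R `^ (- s) = N%:R `^ (1 - s) / N%:R :> R.
  rewrite addrC powRD; last by rewrite (gt_eqF Npos) implybT.
  by rewrite powRr1 ?mulfK ?gt_eqF// ltW.
have NP : 0 < (N%:R * cos 1) ^+ 2 :> R by rewrite exprn_gt0// mulr_gt0.
rewrite -(ler_pM2l NP) (le_trans S_le)// (le_trans D_le)//.
have -> : (N%:R * cos 1) ^+ 2 * (2 * (m + 2 * C / (1 - s)) / cos 1 ^+ 2 *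
    (N%:R `^ (1 - s) / N%:R)) =
    N%:R * (2 * (m * N%:R `^ (1 - s) + 2 * C / (1 - s) * N%:R `^ (1 - s))).
  by field; rewrite !gt_eqF// subr_gt0.
by rewrite ler_pM2l// ler_pM2l// lerD2r ler_peMr.
Qed.

End slab.

(** * Covering by tangent slabs and the upper bound on the exponent *)

Section upper_bound.
Variable R : realType.
Local Notation R3 := ((R * R) * R)%type.

Lemma measure_eq0_powRN d (T : measurableType d) (mu : {measure set T -> \bar R})
    (E : set T) (K a : R) : 0 < a ->
  (forall m : nat, (0 < m)%N -> (mu E <= (K * m%:R `^ (- a))%:E)%E) ->
  mu E = 0%E.
Proof.
move=> a0 muE; apply/eqP; rewrite -measure_le0; apply/lee_addgt0Pr => eps eps0.
(* [b] solves [b^a = |K| / eps], so any [m > b] brings the bound down to [eps]. *)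
rewrite add0e; pose b := (`|K| / eps) `^ a^-1.
have b0 : 0 <= b by exact: powR_ge0.
have /andP[_ bm] := truncn_itv b0; set m := (Num.trunc b).+1 in bm.
apply: le_trans (muE m isT) _; rewrite lee_fin powRN.
have m0 : 0 < m%:R `^ a :> R by rewrite powR_gt0// ltr0n.
rewrite ler_pdivrMr// -ler_pdivrMl// mulrC (le_trans (ler_norm _))// normrM.
rewrite (gtr0_norm (x := eps^-1)) ?invr_gt0//.
have -> : `|K| / eps = b `^ a.
  by rewrite /b -powRrM mulVf ?gt_eqF// powRr1// divr_ge0// ltW.
by rewrite ge0_ler_powR ?nnegrE ?ler0n// ltW.
Qed.

Variables (P : R -> R -> R3) (n : R -> R3) (c : R -> R).
Hypothesis n1 : forall y, 1 <= c2 (n y).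
(* The plane [dot3 _ (n y) = c y] is tangent to the surface along the ruling [P y]. *)
Hypothesis tangent : forall M : nat, exists B : R, forall x y h,
  `|x| <= M%:R -> `|y| <= M%:R -> `|h| <= M%:R ->
  `|dot3 (P x h) (n y) - c y| <= B * (x - y) ^+ 2.

(** The rulings are sampled with spacing [1 / (q m)]. The tangency error [|B| / (q m)^2] then fits
    into the slab radius [1 / (8 m^2)], while the number of slabs is linear in [m], with [J]
    independent of [m]. *)
Lemma slab_cover (M : nat) : exists (J : nat) (y : nat -> nat -> R),
  forall m : nat, (0 < m)%N -> forall x h, `|x| <= M%:R -> `|h| <= M%:R ->
  exists2 j : nat, (j < J * m)%N &
    slab (n (y m j)) (c (y m j)) (8 * (m ^ 2)%:R)^-1 (P x h).
Proof.
have [B PB] := tangent M.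
(* The choice gives [q^2 >= q >= 8 |B|]. *)
pose q : nat := (Num.trunc (8 * `|B|)).+1.
have Bq : 8 * `|B| <= q%:R ^+ 2.
  have B8 : 0 <= 8 * `|B| by rewrite mulr_ge0.
  have /andP[_ /ltW Bq] := truncn_itv B8; apply: le_trans Bq _.
  by rewrite ler_eXnr// ler1n.
have q0 : 0 < q%:R :> R by rewrite ltr0n.
(* The successor leaves room for the index [2 M q m], reached at [x = M]. *)
exists (2 * M * q).+1, (fun m j => - M%:R + j%:R / (q * m)%:R) => m m0 x h xM hM.
have qm0 : 0 < (q * m)%:R :> R by rewrite ltr0n muln_gt0.
have := xM; rewrite ler_norml => /andP[Mx xM'].
have t0 : 0 <= (x + M%:R) * (q * m)%:R by rewrite mulr_ge0 ?ler0n//; lra.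
have /andP[jt tj] := truncn_itv t0; set j := Num.trunc _ in jt tj.
have jx : j%:R / (q * m)%:R <= x + M%:R by rewrite ler_pdivrMr.
have xj : x + M%:R < j%:R / (q * m)%:R + (q * m)%:R^-1.
  have : x + M%:R < j.+1%:R / (q * m)%:R by rewrite ltr_pdivlMr.
  by rewrite -natr1 mulrDl mul1r.
have j0 : 0 <= j%:R / (q * m)%:R :> R by rewrite divr_ge0.
exists j.
  rewrite -(ltr_nat R) (le_lt_trans jt)//.
  have xM2 : x + M%:R <= 2 * M%:R by lra.
  rewrite (le_lt_trans (ler_wpM2r (ltW qm0) xM2))//.
  rewrite (_ : ((2 * M * q).+1 * m)%:R = 2 * M%:R * (q * m)%:R + m%:R).
    by rewrite ltrDl ltr0n.
  by rewrite mulSn natrD addrC !natrM !mulrA.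
set y := - M%:R + _; have yM : `|y| <= M%:R by rewrite ler_norml /y; lra.
rewrite /slab /= (le_trans (PB x y h xM yM hM))//.
have xy0 : 0 <= x - y by rewrite /y; lra.
have xy : x - y <= (q * m)%:R^-1 by rewrite /y; lra.
have xy2 : (x - y) ^+ 2 <= ((q * m)%:R^-1) ^+ 2 by rewrite lerXn2r ?nnegrE ?invr_ge0.
apply: le_trans (_ : `|B| * ((q * m)%:R^-1) ^+ 2 <= _).
  apply: le_trans (ler_wpM2r (sqr_ge0 _) (ler_norm B)) _.
  by rewrite ler_wpM2l.
rewrite exprVn natrM exprMn natrX.
have m20 : 0 < m%:R ^+ 2 :> R by rewrite exprn_gt0// ltr0n.
have q20 : 0 < q%:R ^+ 2 :> R by rewrite exprn_gt0.
have qm20 : 0 < q%:R ^+ 2 * m%:R ^+ 2 :> R by exact: mulr_gt0.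
have m80 : 0 < 8 * m%:R ^+ 2 :> R by exact: mulr_gt0.
by rewrite ler_pdivrMr// ler_pdivlMl// mulrAC ler_pM2r.
Qed.

Lemma decay_exponent_le1 (A : set R3) (mu : {measure set R3 -> \bar R}) (s C : R) :
  A `<=` [set p | exists x h, p = P x h] -> MA A mu ->
  (forall xi, norm3 xi `^ (s / 2) * ft_abs mu xi <= C) -> s <= 1.
Proof.
move=> AP [mu0 [muT muA]] decay; rewrite leNgt; apply/negP => s1.
(* The slab estimate asks for an exponent below 1; truncating at [3 / 4] keeps it above [1 / 2], and
   for [|xi| >= 1] a smaller exponent preserves the decay. *)
pose r : R := Num.min (s / 2) (3 / 4).
have r01 : 0 < r < 1 by rewrite lt_min gt_min; lra.
have r2 : 0 < 2 * r - 1.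
  by rewrite subr_gt0 -ltr_pdivrMl// lt_min; lra.
have rdecay xi : 1 <= norm3 xi -> norm3 xi `^ r * ft_abs mu xi <= `|C|.
  move=> xi1; rewrite (le_trans _ (ler_norm C))// (le_trans _ (decay xi))//.
  by rewrite ler_wpM2r ?sqrtr_ge0// ler_powR// ge_min lexx.
have slab_le y d N (N0 : (0 < N)%N) :=
  @measure_slab_le _ _ muT (n y) d _ _ N r01 (normr_ge0 C) (n1 y) N0 rdecay.
set K := _ / cos 1 ^+ 2 in slab_le.
have K0 : 0 <= K.
  have /andP[_ r1] := r01.
  apply: divr_ge0; last exact: sqr_ge0.
  apply: mulr_ge0 => //; apply: addr_ge0; first exact: fine_ge0.
  by apply: divr_ge0; [exact: mulr_ge0|rewrite subr_ge0 ltW].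
(* With [N = m^2], the [J m] slabs have total mass [O(m^(1 - 2 r))], which tends to 0. The
   intersection of the covers over all [m] is then a measurable null superset. *)
have bounded_part (M : nat) : mu.-negligible
    [set p | exists x h, [/\ `|x| <= M%:R, `|h| <= M%:R & p = P x h]].
  have [J [y Jy]] := slab_cover M.
  pose S m j := slab (n (y m j)) (c (y m j)) (8 * (m ^ 2)%:R)^-1.
  pose cover (m : nat) := \big[setU/set0]_(j < J * m) S m j.
  have mcover m : measurable (cover m).
    by apply: bigsetU_measurable => j _; exact: measurable_slab.
  exists (\bigcap_(m in [set m | (0 < m)%N]) cover m); split.
  - by apply: bigcap_measurable => //; exists 1%N.
  - apply: (measure_eq0_powRN (K := J%:R * K) r2) => m m0.
    apply: le_trans (_ : (mu (cover m) <= _)%E).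
      rewrite le_measure ?inE//; first by apply: bigcap_measurable => //; exists 1%N.
      by move=> p; exact.
    have mS j : (j < J * m)%N -> measurable (S m j).
      by move=> _; exact: measurable_slab.
    apply: le_trans (Boole_inequality mu mS) _.
    have fin j : mu (S m j) \is a fin_num.
      rewrite ge0_fin_numE// (le_lt_trans _ muT)// le_measure ?inE//.
      exact: measurable_slab.
    apply: le_trans (_ : (\sum_(j < J * m) (K * (m ^ 2)%:R `^ (- r))%:E <= _)%E).
      apply: lee_sum => j _.
      have m20 : (0 < m ^ 2)%N by rewrite expn_gt0 m0.
      by have := slab_le (y m j) (c (y m j)) _ m20; rewrite -lee_fin (fineK (fin j)).
    rewrite sumEFin lee_fin big_const_ord iter_addr_0 -[leLHS]mulr_natl.
    rewrite (natrM _ J m) natrX -powR_mulrn// -powRrM mulrN opprB.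
    have -> : m%:R `^ (1 - 2 * r) = m%:R * m%:R `^ - (2 * r) :> R.
      rewrite powRD ?powRr1//.
      by rewrite pnatr_eq0 -lt0n m0 implybT.
    by rewrite le_eqVlt; apply/orP; left; apply/eqP; ring.
  - by move=> p [x [h [xM hM ->]]] m /= m0; rewrite /cover -bigcup_mkord; exact: Jy.
have : mu.-negligible setT.
  rewrite -(setUv A); apply: negligibleU; last exact: negligible_setC_supported.
  apply: negligibleS (negligible_bigcup bounded_part) => p /AP[x [h ->]].
  have [/ltW xM /ltW hM] : `|x| < (Num.trunc `|x|).+1%:R /\ `|h| < (Num.trunc `|h|).+1%:R.
    by split; [have /andP[] := truncn_itv (normr_ge0 x)|
      have /andP[] := truncn_itv (normr_ge0 h)].
  exists (maxn (Num.trunc `|x|).+1 (Num.trunc `|h|).+1) => //=; exists x, h; split => //.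
    by rewrite (le_trans xM)// ler_nat leq_maxl.
  by rewrite (le_trans hM)// ler_nat leq_maxr.
by move/negligibleP => /(_ measurableT) muT0; move: mu0; rewrite muT0 eqxx.
Qed.

End upper_bound.

(** * Van der Corput's estimate for polynomial phases *)

Section van_der_corput.
Variable R : realType.
Local Notation mu := (@lebesgue_measure R).

Lemma Rintegral_le_primitive (u F f : R -> R) (a b : R) : a < b ->
  continuous u -> continuous f -> (forall x : R, is_derive x 1 F (f x)) ->
  (forall x, a <= x <= b -> u x <= f x) ->
  Rintegral mu `[a, b] u <= F b - F a.
Proof.
move=> ab cu cf dF uf.
have cF : continuous F.
  move=> x; apply: differentiable_continuous; apply/derivable1_diffP.
  by have [] := dF x.
have itg (v : R -> R) : continuous v -> mu.-integrable `[a, b] (EFin \o v).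
  move=> cv; apply: continuous_compact_integrable; first exact: segment_compact.
  exact: continuous_subspaceT.
have <- : Rintegral mu `[a, b] f = F b - F a.
  rewrite /Rintegral (@continuous_FTC2 _ f F)//.
  - exact: continuous_subspaceT.
  - split.
    + by move=> x _; have [] := dF x.
    + exact/cvg_at_right_filter/cF.
    + exact/cvg_at_left_filter/cF.
  - by move=> x _; rewrite derive1E; have [] := dF x.
apply: le_Rintegral; [exact: measurable_itv|exact: itg|exact: itg|].
by move=> x /=; rewrite in_itv; exact: uf.
Qed.

(** [g] is a primitive of a bound for the error term. It is left open because it is chosen according
    to the phase: linear for a large first derivative, an arctangent for a large second one. *)
Variables (p : {poly R}) (a b L : R) (g g' : R -> R).
Hypotheses (ab : a < b) (L0 : 0 < L).
Hypothesis dg : forall x : R, is_derive x 1 g (g' x).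
Hypothesis cg' : continuous g'.
Hypothesis g'_ge : forall x, a <= x <= b ->
  (L + `|p^`()^`().[x]|) / (p^`().[x] ^+ 2 + L) <= g' x.

Let q : {poly R} := p^`() ^+ 2 + L%:P.

Let q_gt0 x : 0 < q.[x].
Proof. by rewrite /q !hornerE ltr_wpDl// sqr_ge0. Qed.

(* Up to an error of size [g'], the function [sin p * p' / (p'^2 + L)] is a
   primitive of [cos p]; the term [L] removes the singularities of the usual
   [sin p / p'] at the stationary points. *)
Lemma Rintegral_cos_poly_le t :
  Rintegral mu `[a, b] (fun x => cos (p.[x] + t)) <=
  (Num.sqrt L)^-1 + (g b - g a).
Proof.
pose F x := sin (p.[x] + t) * (p^`().[x] / q.[x]) + g x.
pose f x := cos (p.[x] + t) * (p^`().[x] ^+ 2 / q.[x]) +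
  sin (p.[x] + t) * (p^`()^`().[x] * (L - p^`().[x] ^+ 2) / q.[x] ^+ 2) + g' x.
have dF (x : R) : is_derive x 1 F (f x).
  have dq : is_derive x 1 (fun y => q.[y]^-1) (- q.[x] ^- 2 *: q^`().[x]).
    by apply: is_deriveV; rewrite gt_eqF.
  have ds : is_derive x 1 (fun y => sin (p.[y] + t)) (cos (p.[x] + t) * (p^`().[x] + 0)).
    apply: (@is_derive1_comp _ (@sin R) (fun y => p.[y] + t)).
  have := is_deriveD (is_deriveM ds (is_deriveM (is_derive_poly p^`() x) dq)) (dg x).
  move=> /is_derive_eq; apply.
  have qE : q.[x] = p^`().[x] ^+ 2 + L by rewrite /q !hornerE.
  have q'E : q^`().[x] = 2 * (p^`()^`().[x] * p^`().[x]).
    by rewrite /q expr2 derivD derivM derivC addr0 hornerD !hornerM; ring.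
  have q0 := q_gt0 x; rewrite fctE /f q'E /GRing.scale/= qE; field.
  by rewrite -qE gt_eqF.
have cp (r : {poly R}) : continuous (fun x => r.[x]).
  exact: continuous_horner.
have cpt : continuous (fun x => p.[x] + t).
  by move=> x; apply: cvgD; [exact: cp|exact: cvg_cst].
have ccos : continuous (fun x => cos (p.[x] + t)).
  by move=> x; apply: continuous_comp; [exact: cpt|exact: continuous_cos].
have csin : continuous (fun x => sin (p.[x] + t)).
  by move=> x; apply: continuous_comp; [exact: cpt|exact: continuous_sin].
have cq : continuous (fun x => q.[x]^-1).
  by move=> x; apply: cvgV; [rewrite gt_eqF|exact: cp].
have cq2 : continuous (fun x => (q.[x] ^+ 2)^-1).
  move=> x; apply: cvgV; first by rewrite expf_neq0// gt_eqF.
  by apply: cvgM; exact: cp.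
have cf : continuous f.
  rewrite /f => x; apply: cvgD; last exact: cg'.
  apply: cvgD; apply: cvgM.
  - exact: ccos.
  - apply: cvgM; last exact: cq.
    by apply: cvgM; exact: cp.
  - exact: csin.
  - apply: cvgM; last exact: cq2.
    apply: cvgM; first exact: cp.
    by apply: cvgB; [exact: cvg_cst|apply: cvgM; exact: cp].
have qE x : q.[x] = p^`().[x] ^+ 2 + L by rewrite /q !hornerE.
apply: le_trans (Rintegral_le_primitive ab ccos cf dF _) _.
  move=> x xab; rewrite /f -lerBlDl (le_trans _ (g'_ge xab))//.
  rewrite -qE mulrDl.
  set d1 := p^`().[x]; set d2 := p^`()^`().[x].
  set C := cos _; set S := sin _.
  have q0 := q_gt0 x; have qd : q.[x] = d1 ^+ 2 + L by exact: qE.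
  (* The error splits into [C L / q] and [d2 / q] times factors of absolute value at most 1, one of
     them [(L - d1^2) / q]. *)
  have -> : C - (C * (d1 ^+ 2 / q.[x]) + S * (d2 * (L - d1 ^+ 2) / q.[x] ^+ 2)) =
      C * (L / q.[x]) - S * (d2 * ((L - d1 ^+ 2) / q.[x]) / q.[x]).
    by rewrite qd; field; rewrite -qd gt_eqF.
  apply: lerD.
    by rewrite ler_piMl ?cos_le1// divr_ge0// ltW.
  rewrite (le_trans (ler_norm _))// normrN !normrM.
  rewrite (gtr0_norm (x := q.[x]^-1)) ?invr_gt0// mulrA ler_wpM2r ?invr_ge0 ?(ltW q0)//.
  rewrite mulrCA ler_piMr// mulr_ile1 ?sin_max// ?mulr_ge0 ?invr_ge0 ?(ltW q0)//.
  rewrite ler_pdivrMr// mul1r qd ler_norml.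
  by move: (sqr_ge0 d1) L0; move: (d1 ^+ 2) => D D0 L0'; lra.
rewrite /F opprD addrACA lerD2r.
have sL0 : 0 < Num.sqrt L by rewrite sqrtr_gt0.
(* From [2 |p'| sqrt L <= p'^2 + L], each of the two boundary terms is at most half of
   [1 / sqrt L]. *)
have small x : `|sin (p.[x] + t) * (p^`().[x] / q.[x])| <= 2^-1 * (Num.sqrt L)^-1.
  rewrite normrM (le_trans (ler_piMl _ (sin_max _)))//.
  rewrite normrM (gtr0_norm (x := q.[x]^-1)) ?invr_gt0//.
  rewrite ler_pdivrMr// qE mulrAC ler_pdivlMr//.
  have -> : p^`().[x] ^+ 2 + L = `|p^`().[x]| ^+ 2 + Num.sqrt L ^+ 2.
    by rewrite sqr_sqrtr ?(ltW L0)// real_normK// num_real.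
  have := sqr_ge0 (`|p^`().[x]| - Num.sqrt L); lra.
have := small a; have := small b; rewrite !ler_norml; lra.
Qed.

(** Shifting the phase by [pi] changes the sign of the integrand, so the upper bound for all phases
    also yields the lower one. *)
Lemma normr_Rintegral_cos_poly_le t :
  `|Rintegral mu `[a, b] (fun x => cos (p.[x] + t))| <=
  (Num.sqrt L)^-1 + (g b - g a).
Proof.
rewrite ler_norml Rintegral_cos_poly_le andbT lerNl.
apply: le_trans (Rintegral_cos_poly_le (t + pi)).
rewrite -mulN1r -RintegralZl//; first last.
  apply: continuous_compact_integrable; first exact: segment_compact.
  apply: continuous_subspaceT => x; apply: continuous_comp; last exact: continuous_cos.
  by apply: cvgD; [exact: continuous_horner|exact: cvg_cst].
rewrite le_eqVlt; apply/orP; left; apply/eqP; apply: eq_Rintegral => x _.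
by rewrite addrA cosDpi mulN1r.
Qed.

End van_der_corput.

(** * Cubic phases on a short interval *)

Section cubic_phase.
Variable R : realType.
Local Notation mu := (@lebesgue_measure R).
Implicit Types (e u v t b L x : R).

(** The pairing of [(u, v)] with the curve [(x + e x^3, x^2)], hence the common factor [u] in the
    linear and cubic coefficients. *)
Let phase e u v : {poly R} := u *: 'X + v *: 'X^2 + (e * u) *: 'X^3.

Let phaseE e u v x : (phase e u v).[x] = u * (x + e * x ^+ 3) + v * x ^+ 2.
Proof. by rewrite /phase !hornerD !hornerZ !hornerXn hornerX; ring. Qed.

Let dphaseE e u v x :
  (phase e u v)^`().[x] = u * (1 + 3 * e * x ^+ 2) + 2 * v * x.
Proof.
rewrite /phase !derivD !derivZ derivX !derivXn /=.
by rewrite !hornerD !hornerZ !hornerMn !hornerXn hornerC; ring.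
Qed.

Let ddphaseE e u v x : (phase e u v)^`()^`().[x] = 2 * v + 6 * e * u * x.
Proof.
rewrite /phase !derivD !derivZ derivX !derivXn derivC !derivMn !derivXn /=.
by rewrite !hornerD !hornerZ !hornerMn !hornerXn !hornerC; ring.
Qed.

(** On [[0, 1/10]] the first derivative is at least [4 u / 5] and the second at most [13 u / 5] in
    absolute value. The error is thus below the constant [6 / u], and a linear [g] suffices. *)
Lemma cubic_phase_linear_le e u v t b : 0 < b <= 10^-1 -> 0 <= e <= 1 ->
  1 <= u -> `|v| <= u ->
  `|Rintegral mu `[0, b] (fun x => cos (u * (x + e * x ^+ 3) + v * x ^+ 2 + t))|
  <= 9 / Num.sqrt u.
Proof.
move=> /andP[b0 b1] /andP[e0 e1] u1 vu; have u0 : 0 < u by lra.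
move: (vu); rewrite ler_norml => /andP[v1 v2].
have dg x : is_derive x 1 (fun y => 6 / u * y) (6 / u).
  have := @is_deriveZ _ _ _ id (6 / u) x 1 1 _.
  by rewrite /GRing.scale/= mulr1; apply.
have cg : continuous (fun _ : R => 6 / u) by move=> x; exact: cvg_cst.
have := @normr_Rintegral_cos_poly_le R (phase e u v) 0 b u _ _ b0 u0 dg cg.
under [in X in _ -> X]eq_Rintegral do rewrite -phaseE.
move=> H; apply: le_trans (H _ t) _ => [x /andP[x0 xb]|].
  rewrite dphaseE ddphaseE.
  have x1 : x <= 10^-1 by lra.
  have vx : - (u / 10) <= v * x <= u / 10 by nra.
  have ex : 0 <= e * u * x <= u / 10.
    have eu : 0 <= e * u <= u by nra.
    nra.
  have d1 : 4 / 5 * u <= u * (1 + 3 * e * x ^+ 2) + 2 * v * x.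
    have : 0 <= e * u * x * x by nra.
    nra.
  set d := u * _ + _ in d1 *.
  have d2 : 16 / 25 * u ^+ 2 <= d ^+ 2 by nra.
  have n2 : `|2 * v + 6 * e * u * x| <= 13 / 5 * u by rewrite ler_norml; lra.
  have d0 : 0 < d ^+ 2 + u by have := sqr_ge0 d; lra.
  rewrite ler_pdivrMr// [leRHS]mulrAC ler_pdivlMr//.
  have : 0 <= u * (13 / 5 * u - `|2 * v + 6 * e * u * x|).
    by apply: mulr_ge0; [exact: ltW|rewrite subr_ge0].
  nra.
have su : 0 < Num.sqrt u by rewrite sqrtr_gt0.
have su1 : 1 <= Num.sqrt u by rewrite -sqrtr1 ler_wsqrtr.
rewrite mulr0 subr0 -[leRHS]mulrC.
have -> : 6 / u * b = (Num.sqrt u)^-1 * (6 * b / Num.sqrt u).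
  by rewrite -[in LHS](sqr_sqrtr (ltW u0)); field; rewrite gt_eqF.
rewrite -{1}[(Num.sqrt u)^-1]mulr1 -mulrDr ler_pM2l ?invr_gt0//.
have : 6 * b / Num.sqrt u <= 1 by rewrite ler_pdivrMr//; lra.
lra.
Qed.

(** Now [p'' >= 7 v / 5], hence [v + p'' <= 2 p''], and [2 p'' / (p'^2 + v)] is the derivative of a
    multiple of an arctangent. Its variation is at most [2 pi / sqrt v], even across a stationary
    point; the constant 9 comes from [1 + 2 pi < 9]. *)
Lemma cubic_phase_quadratic_le e u v t b : 0 < b <= 10^-1 -> 0 <= e <= 1 ->
  1 <= v -> `|u| <= v ->
  `|Rintegral mu `[0, b] (fun x => cos (u * (x + e * x ^+ 3) + v * x ^+ 2 + t))|
  <= 9 / Num.sqrt v.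
Proof.
move=> /andP[b0 b1] /andP[e0 e1] v1 uv; have v0 : 0 < v by lra.
move: (uv); rewrite ler_norml => /andP[u1 u2].
have sv : 0 < Num.sqrt v by rewrite sqrtr_gt0.
pose p := phase e u v.
pose g x := 2 / Num.sqrt v * atan (p^`().[x] / Num.sqrt v).
pose g' x := 2 * p^`()^`().[x] / (p^`().[x] ^+ 2 + v).
have dpos x : 0 < p^`().[x] ^+ 2 + v by rewrite ltr_wpDl// sqr_ge0.
have dg x : is_derive x 1 g (g' x).
  have da : is_derive x 1 (fun y => atan (p^`().[y] / Num.sqrt v))
      ((1 + (p^`().[x] / Num.sqrt v) ^+ 2)^-1 *
       (p^`().[x] *: (0 : R) + (Num.sqrt v)^-1 *: p^`()^`().[x])).
    apply: (@is_derive1_comp _ (@atan R) (fun y => p^`().[y] / Num.sqrt v)).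
    exact: (is_deriveM (is_derive_poly p^`() x) (is_derive_cst (Num.sqrt v)^-1 x 1)).
  have := @is_deriveZ _ _ _ _ (2 / Num.sqrt v) x 1 _ da.
  move=> /is_derive_eq; apply.
  rewrite /g' /GRing.scale/= mulr0 add0r -[in RHS](sqr_sqrtr (ltW v0)).
  have := dpos x; rewrite -{1}(sqr_sqrtr (ltW v0)) => d0.
  field; rewrite !gt_eqF//.
have cg : continuous g'.
  move=> x; apply: cvgM.
    by apply: cvgM; [exact: cvg_cst|exact: continuous_horner].
  apply: cvgV; first by rewrite gt_eqF.
  by apply: cvgD; [apply: cvgM; exact: continuous_horner|exact: cvg_cst].
have := @normr_Rintegral_cos_poly_le R p 0 b v _ _ b0 v0 dg cg.
under [in X in _ -> X]eq_Rintegral do rewrite -phaseE.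
move=> H; apply: le_trans (H _ t) _ => [x /andP[x0 xb]|].
  rewrite /g' ler_pM2r ?invr_gt0// ddphaseE.
  have x1 : x <= 10^-1 by lra.
  have ex : - (v / 10) <= e * u * x <= v / 10.
    have eu : - v <= e * u <= v by nra.
    nra.
  by rewrite ger0_norm; lra.
rewrite /g -mulrBr -[leRHS]mulrC [X in _ + X]mulrAC [X in _ + X]mulrC.
rewrite -{1}[(Num.sqrt v)^-1]mulr1 -mulrDr ler_pM2l ?invr_gt0//.
have := atan_gtNpi2 (p^`().[0] / Num.sqrt v).
have := atan_ltpi2 (p^`().[b] / Num.sqrt v).
have := pihalf_lt2 R; lra.
Qed.

(** The larger of [|u|] and [|v|] decides between the linear and the quadratic case; the cosine
    being even, all signs can be reversed to make that coefficient positive. *)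
Lemma cubic_phase_le e u v t b L : 0 < b <= 10^-1 -> 0 <= e <= 1 ->
  1 <= L -> (L <= `|u|) || (L <= `|v|) ->
  `|Rintegral mu `[0, b] (fun x => cos (u * (x + e * x ^+ 3) + v * x ^+ 2 + t))|
  <= 9 / Num.sqrt L.
Proof.
move=> b01 e01 L1 Luv.
have anti m : L <= m -> 9 / Num.sqrt m <= 9 / Num.sqrt L.
  move=> Lm; rewrite ler_pM2l// lef_pV2 ?posrE ?sqrtr_gt0 ?ler_wsqrtr//; lra.
have cos_opp : Rintegral mu `[0, b]
      (fun x => cos (u * (x + e * x ^+ 3) + v * x ^+ 2 + t)) =
    Rintegral mu `[0, b]
      (fun x => cos ((- u) * (x + e * x ^+ 3) + (- v) * x ^+ 2 + (- t))).
  by apply: eq_Rintegral => x _; rewrite -cosN; congr cos; ring.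
have [vu|uv] := leP `|v| `|u|.
  have Lu : L <= `|u| by case/orP: Luv => // /le_trans; exact.
  apply: le_trans (anti _ Lu); have [u0|u0] := ger0P u; last rewrite cos_opp.
    by apply: cubic_phase_linear_le => //; move: vu Lu; rewrite (ger0_norm u0); lra.
  by apply: cubic_phase_linear_le => //; move: vu Lu; rewrite ?normrN (ltr0_norm u0) //; lra.
have Lv : L <= `|v| by case/orP: Luv => // /le_trans; apply; exact: ltW.
apply: le_trans (anti _ Lv); have [v0|v0] := ger0P v; last rewrite cos_opp.
  by apply: cubic_phase_quadratic_le => //; move: uv Lv; rewrite (ger0_norm v0); lra.
by apply: cubic_phase_quadratic_le => //; move: uv Lv; rewrite ?normrN (ltr0_norm v0) //; lra.
Qed.

End cubic_phase.

(** * Integration over the uniform square *)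

Section uniform_square.
Variable R : realType.
Local Notation R3 := ((R * R) * R)%type.
Local Notation mu := (@lebesgue_measure R).

Lemma normr_Rintegral_le_cst d (T : measurableType d)
    (m : {measure set T -> \bar R}) (D : set T) (h : T -> R) (K : R) :
  measurable D -> (m D < +oo)%E -> measurable_fun D h -> 0 <= K ->
  (forall x, D x -> `|h x| <= K) ->
  `|Rintegral m D h| <= K * fine (m D).
Proof.
move=> mD mDoo mh K0 hK.
have ih : m.-integrable D (EFin \o h).
  apply: measurable_bounded_integrable => //.
  exists K; split; first exact: num_real.
  by move=> M KM x Dx; exact: le_trans (hK _ Dx) (ltW KM).
rewrite (le_trans (le_normr_Rintegral mD ih))// -Rintegral_cst//.
apply: le_Rintegral => //; first exact: integrable_norm.
apply: measurable_bounded_integrable => //.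
exists K; split; first exact: num_real.
by move=> M KM x Dx /=; rewrite ger0_norm// ltW.
Qed.

Lemma probability_setT_lty d (T : measurableType d) (m : probability T R) :
  (m setT < +oo)%E.
Proof. by rewrite probability_setT ltry. Qed.

Lemma Rintegral_prod12 d1 d2 (T1 : measurableType d1) (T2 : measurableType d2)
    (m1 : probability T1 R) (m2 : probability T2 R) (h : T1 * T2 -> R) (K : R) :
  measurable_fun setT h -> (forall z, `|h z| <= K) ->
  Rintegral (m1 \x m2)%E setT h =
  Rintegral m1 setT (fun x => Rintegral m2 setT (fun y => h (x, y))).
Proof.
move=> mh hK.
have ih : (m1 \x m2)%E.-integrable setT (EFin \o h).
  apply: (bounded_finite_integrable _ mh hK).
  exact: (probability_setT_lty (m1 \x m2)%E).
rewrite /Rintegral -integral12_prod_meas1//; congr fine.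
apply: eq_integral => x _; rewrite /fubini_F fineK//.
apply: integrable_fin_num => //.
apply: (bounded_finite_integrable (B := K)) => //.
  exact: probability_setT_lty.
exact: measurableT_comp.
Qed.

Lemma Rintegral_prod21 d1 d2 (T1 : measurableType d1) (T2 : measurableType d2)
    (m1 : probability T1 R) (m2 : probability T2 R) (h : T1 * T2 -> R) (K : R) :
  measurable_fun setT h -> (forall z, `|h z| <= K) ->
  Rintegral (m1 \x m2)%E setT h =
  Rintegral m2 setT (fun y => Rintegral m1 setT (fun x => h (x, y))).
Proof.
move=> mh hK.
have ih : (m1 \x m2)%E.-integrable setT (EFin \o h).
  apply: (bounded_finite_integrable _ mh hK).
  exact: (probability_setT_lty (m1 \x m2)%E).
rewrite /Rintegral -integral21_prod_meas1//; congr fine.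
apply: eq_integral => y _; rewrite /fubini_G fineK//.
apply: integrable_fin_num => //.
apply: (bounded_finite_integrable (B := K)) => //.
  exact: probability_setT_lty.
exact: measurableT_comp.
Qed.

Lemma measurable_Rintegral12 d1 d2 (T1 : measurableType d1) (T2 : measurableType d2)
    (m1 : probability T1 R) (m2 : probability T2 R) (h : T1 * T2 -> R) (K : R) :
  measurable_fun setT h -> (forall z, `|h z| <= K) ->
  measurable_fun setT (fun x => Rintegral m2 setT (fun y => h (x, y))).
Proof.
move=> mh hK; apply: measurableT_comp => //=.
have ih : (m1 \x m2)%E.-integrable setT (EFin \o h).
  apply: (bounded_finite_integrable _ mh hK).
  exact: (probability_setT_lty (m1 \x m2)%E).
exact: (measurable_fubini_F ih).
Qed.

Lemma measurable_Rintegral21 d1 d2 (T1 : measurableType d1) (T2 : measurableType d2)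
    (m1 : probability T1 R) (m2 : probability T2 R) (h : T1 * T2 -> R) (K : R) :
  measurable_fun setT h -> (forall z, `|h z| <= K) ->
  measurable_fun setT (fun y => Rintegral m1 setT (fun x => h (x, y))).
Proof.
move=> mh hK; apply: measurableT_comp => //=.
have ih : (m1 \x m2)%E.-integrable setT (EFin \o h).
  apply: (bounded_finite_integrable _ mh hK).
  exact: (probability_setT_lty (m1 \x m2)%E).
exact: (measurable_fubini_G ih).
Qed.

Variables (b : R) (b0 : 0 < b).
Let nu : probability _ R := uniform_prob b0.

Lemma lebesgue_measure_0b : mu `[0, b] = b%:E.
Proof. by rewrite lebesgue_measure_itv/= lte_fin b0 -EFinB subr0. Qed.

Lemma Rintegral_uniform (h : R -> R) (K : R) : measurable_fun setT h ->
  0 <= K -> (forall x, `|h x| <= K) ->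
  Rintegral nu setT h = b^-1 * Rintegral mu `[0, b] h.
Proof.
move=> mh K0 hK.
(* Adding [K] makes the integrand nonnegative, as [integral_uniform] asks; the constant cancels at
   the end. *)
have mhK : measurable_fun setT (fun x => h x + K) by exact: measurable_funD.
have inu (k : R -> R) B : measurable_fun setT k -> (forall x, `|k x| <= B) ->
    nu.-integrable setT (EFin \o k).
  move=> mk kB; refine (@bounded_finite_integrable R _ _ nu k B _ mk kB).
  exact: probability_setT_lty.
have imu (k : R -> R) B : measurable_fun setT k -> (forall x, `|k x| <= B) ->
    mu.-integrable `[0, b] (EFin \o k).
  move=> mk kB; apply: measurable_bounded_integrable => //.
  - by have := ltry b; rewrite -lebesgue_measure_0b.
  - exact: measurable_funTS.
  - exists B; split; first exact: num_real.
    by move=> M BM x _; exact: le_trans (kB x) (ltW BM).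
have cK (x : R) : `|(cst K : R -> R) x| <= K by rewrite /= ger0_norm.
have : Rintegral nu setT (fun x => h x + K) =
    b^-1 * Rintegral mu `[0, b] (fun x => h x + K).
  rewrite /Rintegral integral_uniform ?subr0//.
  - rewrite fineM//; apply: (integrable_fin_num _ (imu _ (K + K) mhK _)) => // x.
    by rewrite (le_trans (ler_normD _ _))// lerD// ger0_norm.
  - exact/measurable_EFinP.
  - move=> x; rewrite lee_fin; have := hK x; rewrite ler_norml; lra.
rewrite !RintegralD//; [|exact: (imu _ _ mh hK)|exact: (imu _ K)|
  exact: (inu _ _ mh hK)|exact: (inu _ K)].
rewrite !Rintegral_cst//= lebesgue_measure_itv/= lte_fin b0 -EFinB/= subr0.
rewrite (@probability_setT _ _ _ nu) mulrDr mulr1 (mulrCA b^-1) mulVf ?gt_eqF// mulr1.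
by move/addIr.
Qed.

Lemma normr_Rintegral_uniform_le (h : R -> R) (K B : R) : measurable_fun setT h ->
  0 <= B -> (forall x, `|h x| <= B) ->
  0 <= K -> (forall x, 0 <= x <= b -> `|h x| <= K) ->
  `|Rintegral nu setT h| <= K.
Proof.
move=> mh B0 hB K0 hK; rewrite (Rintegral_uniform mh B0 hB) normrM.
rewrite gtr0_norm ?invr_gt0// mulrC ler_pdivrMr//.
rewrite -[leRHS]/(K * fine b%:E) -lebesgue_measure_0b.
apply: normr_Rintegral_le_cst => //.
- by have := ltry b; rewrite -lebesgue_measure_0b.
- exact: measurable_funTS.
Qed.

(** Fubini is applied in the order that integrates the oscillating variable first; the outer
    integral is only an average. *)
Lemma normr_Rintegral_square_le (h : R * R -> R) (K : R) :
  measurable_fun setT h -> (forall z, `|h z| <= 1) -> 0 <= K ->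
  (forall y, 0 <= y <= b -> `|Rintegral mu `[0, b] (fun x => h (x, y))| <= K) \/
  (forall x, 0 <= x <= b -> `|Rintegral mu `[0, b] (fun y => h (x, y))| <= K) ->
  `|Rintegral (nu \x nu)%E setT h| <= b^-1 * K.
Proof.
move=> mh h1 K0 hK.
have bK0 : 0 <= b^-1 * K by rewrite mulr_ge0// invr_ge0 ltW.
have le1 (k : R -> R) : measurable_fun setT k -> (forall x, `|k x| <= 1) ->
    `|Rintegral nu setT k| <= 1.
  by move=> mk k1; apply: (normr_Rintegral_uniform_le mk _ k1).
case: hK => hK.
- rewrite (@Rintegral_prod21 _ _ _ _ nu nu h 1 mh h1).
  have mh1 y : measurable_fun setT (fun x => h (x, y)) by exact: measurableT_comp.
  apply: (@normr_Rintegral_uniform_le _ _ 1) => //.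
  + exact: (@measurable_Rintegral21 _ _ _ _ nu nu h 1 mh h1).
  + by move=> y; apply: le1.
  + move=> y yb; rewrite (@Rintegral_uniform _ 1)// normrM gtr0_norm ?invr_gt0//.
    by rewrite ler_pM2l ?invr_gt0// hK.
- rewrite (@Rintegral_prod12 _ _ _ _ nu nu h 1 mh h1).
  have mh1 x : measurable_fun setT (fun y => h (x, y)) by exact: measurableT_comp.
  apply: (@normr_Rintegral_uniform_le _ _ 1) => //.
  + exact: (@measurable_Rintegral12 _ _ _ _ nu nu h 1 mh h1).
  + by move=> y; apply: le1.
  + move=> y yb; rewrite (@Rintegral_uniform _ 1)// normrM gtr0_norm ?invr_gt0//.
    by rewrite ler_pM2l ?invr_gt0// hK.
Qed.

End uniform_square.

(** * Pushforward of the square and its Fourier decay *)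

Section lower_bound.
Variable R : realType.
Local Notation R3 := ((R * R) * R)%type.
Local Notation mu := (@lebesgue_measure R).
Variables (b : R) (b0 : 0 < b).
Let nu : probability _ R := uniform_prob b0.

Lemma uniform_square_setC0 (B : set (R * R)) : measurable B ->
  (forall x y, 0 <= x <= b -> 0 <= y <= b -> ~ B (x, y)) ->
  (nu \x nu)%E B = 0%E.
Proof.
move=> mB nB; pose I := `[0, b]%classic : set R.
have mI : measurable I by exact: measurable_itv.
have mII : measurable (I `*` I) by exact: measurableX.
have nuI : nu I = 1%E by exact: integral_uniform_pdf1.
have I1 : (nu \x nu)%E (I `*` I) = 1%E.
  by rewrite product_measure1E// [X in (X * X)%E]nuI mule1.
apply/eqP; rewrite -measure_le0.
have : (nu \x nu)%E (~` (I `*` I)) = 0%E.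
  have -> : (nu \x nu)%E (~` (I `*` I)) = (1 - (nu \x nu) (I `*` I))%E.
    exact: (@probability_setC _ _ R (nu \x nu)%E _ mII).
  by rewrite I1 subee.
move=> <-; apply: le_measure; rewrite ?inE//.
  exact: (measurableC mII).
by move=> [x y] Bxy [/= Ix Iy]; apply: (nB x y) => //.
Qed.

Variables (f : R * R -> R3) (A : set R3) (K : R).
Hypotheses (cf : continuous f) (mf : measurable_fun setT f).
Hypothesis fA : forall x y, 0 <= x <= b -> 0 <= y <= b -> A (f (x, y)).
Hypothesis K0 : 0 <= K.
(** Which of the two parameters oscillates may depend on the frequency. The free phase [t] covers
    the real part ([t = 0]) and the imaginary part ([t = - pi / 2]) together. *)
Hypothesis oscillation : forall xi t, 1 <= norm3 xi ->
  (forall y, 0 <= y <= b ->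
    `|Rintegral mu `[0, b] (fun x => cos (2 * pi * dot3 (f (x, y)) xi + t))|
    <= K / Num.sqrt (norm3 xi)) \/
  (forall x, 0 <= x <= b ->
    `|Rintegral mu `[0, b] (fun y => cos (2 * pi * dot3 (f (x, y)) xi + t))|
    <= K / Num.sqrt (norm3 xi)).

Let m : {measure set R3 -> \bar R} :=
  measure_function_pushforward__canonical__measure_function_Measure (nu \x nu)%E mf.

Let Rintegral_m (k : R3 -> R) : measurable_fun setT k ->
  (forall x, `|k x| <= 1) ->
  Rintegral m setT k = Rintegral (nu \x nu)%E setT (k \o f).
Proof.
move=> mk k1; rewrite /Rintegral; congr fine.
have mkf : measurable_fun setT (k \o f) by exact: measurableT_comp.
have ikf : (nu \x nu)%E.-integrable setT (EFin \o (k \o f)).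
  refine (@bounded_finite_integrable R _ _ (nu \x nu)%E (k \o f) 1 _ mkf _).
    exact: (probability_setT_lty (nu \x nu)%E).
  by move=> z; exact: k1.
have mEk : measurable_fun setT (EFin \o k) by exact/measurable_EFinP.
(* [R] and [measurableTypeR R] have convertible sigma-algebras but distinct
   displays, so the source type cannot be inferred. *)
exact: (@integral_pushforward _ _ (measurableTypeR R * measurableTypeR R)%type _ R
  f mf (nu \x nu)%E setT (EFin \o k) mEk ikf measurableT).
Qed.

(** The image of the square is compact, hence closed, and its complement is an open null set. The
    set [A] itself may fail to be closed. *)
Let m_supported : supported_on m A.
Proof.
move=> p pU; apply: contrapT => nAp.
pose I := `[0, b]%classic : set R.
have cI : compact I by exact: segment_compact.
pose S := f @` (I `*` I).
have cS : compact S.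
  apply: continuous_compact; last exact: compact_setX.
  exact: continuous_subspaceT.
have oS : open (~` S).
  by rewrite openC; apply: compact_closed.
have Sp : (~` S) p.
  move=> [[x y] [/= Ix Iy] fp]; apply: nAp; rewrite -fp; apply: fA.
    by move: Ix; rewrite /I /= in_itv.
  by move: Iy; rewrite /I /= in_itv.
have := pU _ oS Sp; suff -> : m (~` S) = 0%E by rewrite ltxx.
apply: uniform_square_setC0.
  by rewrite -[X in measurable X]setTI; apply: mf => //; exact: open_measurable3.
by move=> x y xb yb; apply; exists (x, y) => //; split; rewrite /I /= in_itv.
Qed.

Lemma exists_measure_decay : exists m : {measure set R3 -> \bar R}, MA A m /\
  exists C : R, forall xi, norm3 xi `^ (1 / 2) * ft_abs m xi <= C.
Proof.
have mT : m setT = 1%E by exact: (@probability_setT _ _ R (nu \x nu)%E).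
exists m; split.
  by split; [rewrite mT oner_neq0|split; [rewrite mT ltry|exact: m_supported]].
pose I xi t := Rintegral (nu \x nu)%E setT
  (fun z => cos (2 * pi * dot3 (f z) xi + t)).
have mcos xi t : measurable_fun setT (fun z => cos (2 * pi * dot3 (f z) xi + t)).
  rewrite -[t]opprK.
  exact: (measurableT_comp (measurable_cos_dot3 xi (2 * pi) (- t)) mf).
have reE xi : ft_re m xi = I xi 0.
  rewrite /ft_re /I.
  under [RHS]eq_Rintegral do rewrite addr0.
  apply: (Rintegral_m (k := fun x => cos (2 * pi * dot3 x xi))).
    by have := measurable_cos_dot3 xi (2 * pi) 0; under eq_fun do rewrite subr0.
  by move=> x; exact: cos_max.
have imE xi : ft_im m xi = - I xi (- (pi / 2)).
  rewrite /ft_im /I; congr (- _).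
  under [RHS]eq_Rintegral do rewrite cosBpihalf.
  apply: (Rintegral_m (k := fun x => sin (2 * pi * dot3 x xi))).
    exact: measurable_sin_dot3.
  by move=> x; exact: sin_max.
have absE xi B : (forall t, `|I xi t| <= B) -> ft_abs m xi <= 2 * B.
  move=> IB; have B0 : 0 <= B by exact: le_trans (IB 0).
  rewrite /ft_abs reE imE sqrrN -(ger0_norm (mulr_ge0 _ B0))// -sqrtr_sqr.
  rewrite ler_wsqrtr// -(real_normK (num_real (I xi 0))).
  rewrite -(real_normK (num_real (I xi (- (pi / 2))))).
  have := IB 0; have := IB (- (pi / 2)).
  have := normr_ge0 (I xi 0); have := normr_ge0 (I xi (- (pi / 2))).
  move: `|_| `|_| => u v; nra.
have I1 xi t : `|I xi t| <= 1.
  rewrite -[leRHS]mulr1 -[X in _ * X]/(fine 1%:E) -mT.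
  apply: (@normr_Rintegral_le_cst R _ _ (nu \x nu)%E setT) => //.
  + exact: (probability_setT_lty (nu \x nu)%E).
  + exact: mcos.
  + by move=> z _; exact: cos_max.
(* The summand 2 serves the frequencies of norm below 1, where the integrals are trivially at most
   1; the other summand comes from the oscillation. *)
exists (2 + 2 * (b^-1 * K)) => xi.
have bK0 : 0 <= b^-1 * K by rewrite mulr_ge0// invr_ge0 ltW.
have n0 : 0 <= norm3 xi by exact: sqrtr_ge0.
rewrite div1r powR12_sqrt//; have [n1|n1] := leP 1 (norm3 xi); last first.
  have s1 : Num.sqrt (norm3 xi) <= 1 by rewrite -sqrtr1 ler_wsqrtr// ltW.
  have := absE xi 1 (I1 xi).
  have := sqrtr_ge0 (norm3 xi); have : 0 <= ft_abs m xi by exact: sqrtr_ge0.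
  nra.
have s0 : 0 < Num.sqrt (norm3 xi) by rewrite sqrtr_gt0 (lt_le_trans _ n1).
have IK t : `|I xi t| <= b^-1 * (K / Num.sqrt (norm3 xi)).
  apply: normr_Rintegral_square_le; [exact: mcos|by move=> z; exact: cos_max|
    by rewrite divr_ge0// ltW|exact: oscillation].
have := absE xi _ IK; rewrite -(ler_pM2l s0) => /le_trans; apply.
rewrite (_ : _ * (2 * _) = 2 * (b^-1 * K)); first lra.
by field; rewrite !gt_eqF.
Qed.

End lower_bound.

(** * The two cones and the cylinder *)

Section surfaces.
Variable R : realType.
Local Notation R3 := ((R * R) * R)%type.
Local Notation mu := (@lebesgue_measure R).
Implicit Types (e x y h t b : R) (xi : R3).

Lemma fourier_dim_eq1 (A : set R3) :
  (forall (m : {measure set R3 -> \bar R}) s C, MA A m ->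
    (forall xi, norm3 xi `^ (s / 2) * ft_abs m xi <= C) -> s <= 1) ->
  (exists m : {measure set R3 -> \bar R}, MA A m /\
    exists C : R, forall xi, norm3 xi `^ (1 / 2) * ft_abs m xi <= C) ->
  fourier_dim A = 1.
Proof.
move=> ub1 ex1; rewrite /fourier_dim; set S := [set s | _].
have S1 : S 1 by split => //; lra.
have Sub : ubound S 1 by move=> s [_ [m [mA [C mC]]]]; exact: ub1 mA mC.
apply/eqP; rewrite eq_le; apply/andP; split; first by apply: ge_sup => //; exists 1.
by apply: ub_le_sup => //; exists 1.
Qed.

(** [e = 0] gives the parabolic cone and [e = 1] the perturbed one, so that both are treated at
    once. *)
Definition ruled_cone e x h : R3 := pt (h * (x + e * x ^+ 3)) (h * x ^+ 2) h.
Definition ruled_cylinder x h : R3 := pt x (x ^+ 2) h.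

(* The normal is the cross product of [ruled_cone e y 1] with its derivative in [y]. *)
Lemma cone_exponent_le1 e (A : set R3) (m : {measure set R3 -> \bar R}) (s C : R) :
  0 <= e <= 1 -> A `<=` [set p | exists x h, p = ruled_cone e x h] -> MA A m ->
  (forall xi, norm3 xi `^ (s / 2) * ft_abs m xi <= C) -> s <= 1.
Proof.
move=> /andP[e0 e1]; apply: (@decay_exponent_le1 R _
  (fun y => pt (- 2 * y) (1 + 3 * e * y ^+ 2) (y ^+ 2 - e * y ^+ 4)) (fun=> 0)).
  move=> y; rewrite /c2 /=; have := mulr_ge0 e0 (sqr_ge0 y); lra.
move=> M; exists (M%:R * (1 + 3 * M%:R ^+ 2)) => x y h xM yM hM.
(* The pairing vanishes to second order at [x = y]; the cofactor is at most [M (1 + 3 M^2)] on the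
   bounded part. *)
have -> : dot3 (ruled_cone e x h) (pt (- 2 * y) (1 + 3 * e * y ^+ 2)
    (y ^+ 2 - e * y ^+ 4)) - 0 = h * (1 - e * (y * (2 * x + y))) * (x - y) ^+ 2.
  by rewrite /dot3 /ruled_cone /c1 /c2 /c3 /=; ring.
rewrite normrM (ger0_norm (sqr_ge0 _)) ler_wpM2r ?sqr_ge0//.
rewrite normrM ler_pM// (le_trans (ler_normB _ _))// normr1 lerD2l.
rewrite normrM (ger0_norm e0) -[leRHS]mul1r ler_pM// normrM.
have -> : 3 * M%:R ^+ 2 = M%:R * (2 * M%:R + M%:R) :> R by ring.
rewrite ler_pM// (le_trans (ler_normD _ _))// lerD// normrM ger0_norm//.
by rewrite ler_pM2l.
Qed.

Lemma cylinder_exponent_le1 (A : set R3) (m : {measure set R3 -> \bar R}) (s C : R) :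
  A `<=` [set p | exists x h, p = ruled_cylinder x h] -> MA A m ->
  (forall xi, norm3 xi `^ (s / 2) * ft_abs m xi <= C) -> s <= 1.
Proof.
apply: (@decay_exponent_le1 R _ (fun y => pt (- 2 * y) 1 0) (fun y => - y ^+ 2)).
  by move=> y; rewrite /c2 /=.
move=> M; exists 1 => x y h _ _ _.
have -> : dot3 (ruled_cylinder x h) (pt (- 2 * y) 1 0) - - y ^+ 2 = (x - y) ^+ 2.
  by rewrite /dot3 /ruled_cylinder /c1 /c2 /c3 /=; ring.
by rewrite mul1r ger0_norm// sqr_ge0.
Qed.

(** If the first two coordinates are both below a quarter of the norm, the square of the third
    exceeds [7/8] of the squared norm. *)
Lemma norm3_le4 xi : 1 <= norm3 xi ->
  ~~ ((norm3 xi <= 4 * `|c1 xi|) || (norm3 xi <= 4 * `|c2 xi|)) ->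
  [/\ 4 * `|c1 xi| <= norm3 xi, 4 * `|c2 xi| <= norm3 xi &
      norm3 xi <= 2 * `|c3 xi|].
Proof.
move=> n1; rewrite negb_or -!ltNge => /andP[n4 n5].
split; [exact: ltW|exact: ltW|]; rewrite leNgt; apply/negP => n6.
have nE : norm3 xi ^+ 2 = `|c1 xi| ^+ 2 + `|c2 xi| ^+ 2 + `|c3 xi| ^+ 2.
  rewrite /norm3 sqr_sqrtr /dot3 -?expr2 ?addr_ge0 ?sqr_ge0//.
  by rewrite !real_normK// num_real.
have := normr_ge0 (c1 xi); have := normr_ge0 (c2 xi); have := normr_ge0 (c3 xi).
move: nE n1 n4 n5 n6; move: (norm3 xi) `|c1 xi| `|c2 xi| `|c3 xi| => n u v w.
nra.
Qed.

(** If one of the first two frequency coordinates is at least a quarter of the norm, the phase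
    oscillates along the curve. Otherwise the third one dominates and, [x] being small, the phase is
    linear along the ruling with slope at least [(4 pi / 5) |xi|] in absolute value. *)
Lemma cone_oscillation e b xi t : 0 <= e <= 1 -> 0 < b <= 10^-1 -> 1 <= norm3 xi ->
  (forall y, 0 <= y <= b -> `|Rintegral mu `[0, b] (fun x =>
    cos (2 * pi * dot3 (ruled_cone e x (1 + y)) xi + t))| <= 9 / Num.sqrt (norm3 xi)) \/
  (forall x, 0 <= x <= b -> `|Rintegral mu `[0, b] (fun y =>
    cos (2 * pi * dot3 (ruled_cone e x (1 + y)) xi + t))| <= 9 / Num.sqrt (norm3 xi)).
Proof.
move=> e01 b01 n1; have p2 := pi_ge2 R; have /andP[e0 e1] := e01.
have /andP[_ b1] := b01.
have [n4|/(norm3_le4 n1)[n4 n5 n6]] :=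
    boolP ((norm3 xi <= 4 * `|c1 xi|) || (norm3 xi <= 4 * `|c2 xi|)).
  left => y /andP[y0 yb].
  under eq_Rintegral => x _.
    rewrite (_ : _ + t = 2 * pi * (1 + y) * c1 xi * (x + e * x ^+ 3) +
      2 * pi * (1 + y) * c2 xi * x ^+ 2 + (2 * pi * (1 + y) * c3 xi + t)).
      over.
    by rewrite /dot3 /ruled_cone /c1 /c2 /c3 /=; ring.
  (* The factor 4 makes up for the quarter in the case distinction. *)
  have k4 : 4 <= `|2 * pi * (1 + y)| by rewrite ger0_norm; nra.
  apply: cubic_phase_le => //; rewrite !(normrM (2 * pi * (1 + y))).
  have := normr_ge0 (c1 xi); have := normr_ge0 (c2 xi).
  by case/orP: n4 => n4 c20 c10; apply/orP; [left|right]; nra.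
right => x /andP[x0 xb].
under eq_Rintegral => y _.
  rewrite (_ : _ + t = 2 * pi * (c1 xi * (x + e * x ^+ 3) + c2 xi * x ^+ 2 + c3 xi) *
    (y + 0 * y ^+ 3) + 0 * y ^+ 2 +
    (2 * pi * (c1 xi * (x + e * x ^+ 3) + c2 xi * x ^+ 2 + c3 xi) + t)).
    over.
  by rewrite /dot3 /ruled_cone /c1 /c2 /c3 /=; ring.
(* A linear phase is the case [e = 0], [v = 0] of the cubic one. *)
apply: cubic_phase_le => //; first by rewrite lexx ler01.
apply/orP; left; rewrite normrM (ger0_norm (x := 2 * pi)); last lra.
have x1 : x <= 10^-1 by lra.
have x2 : 0 <= x ^+ 2 <= 10^-1 by nra.
have x3 : 0 <= x + e * x ^+ 3 <= 5^-1.
  have ex : 0 <= e * x <= 10^-1 by nra.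
  rewrite (_ : e * x ^+ 3 = e * x * x ^+ 2); last by ring.
  by apply/andP; split; nra.
(* The curve terms amount to at most [(1/4) (1/5 + 1/10) <= 1/10] of the norm, against at least
   [1/2] from the third coordinate. *)
have a1 : `|c1 xi * (x + e * x ^+ 3) + c2 xi * x ^+ 2| <= norm3 xi / 10.
  rewrite (le_trans (ler_normD _ _))// (normrM (c1 xi)) (normrM (c2 xi)).
  rewrite (ger0_norm (x := x + _)); last by case/andP: x3.
  rewrite (ger0_norm (sqr_ge0 x)).
  have := normr_ge0 (c1 xi); have := normr_ge0 (c2 xi); nra.
have a2 := lerB_normD (c3 xi) (c1 xi * (x + e * x ^+ 3) + c2 xi * x ^+ 2).
rewrite (addrC _ (c3 xi)).
move: a1 a2 n1 n6; move: `|_ + _| `|_ + (_ + _)| => v w a1 a2 n1 n6.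
have w0 : 2 / 5 * norm3 xi <= w by lra.
nra.
Qed.

Lemma cylinder_oscillation b xi t : 0 < b <= 10^-1 -> 1 <= norm3 xi ->
  (forall y, 0 <= y <= b -> `|Rintegral mu `[0, b] (fun x =>
    cos (2 * pi * dot3 (ruled_cylinder x y) xi + t))| <= 9 / Num.sqrt (norm3 xi)) \/
  (forall x, 0 <= x <= b -> `|Rintegral mu `[0, b] (fun y =>
    cos (2 * pi * dot3 (ruled_cylinder x y) xi + t))| <= 9 / Num.sqrt (norm3 xi)).
Proof.
move=> b01 n1; have p2 := pi_ge2 R.
have e01 : 0 <= (0 : R) <= 1 by rewrite lexx ler01.
have pi4 : `|2 * pi| = 2 * pi :> R by rewrite ger0_norm//; lra.
have [n4|/(norm3_le4 n1)[n4 n5 n6]] :=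
    boolP ((norm3 xi <= 4 * `|c1 xi|) || (norm3 xi <= 4 * `|c2 xi|)).
  left => y _.
  under eq_Rintegral => x _.
    rewrite (_ : _ + t = 2 * pi * c1 xi * (x + 0 * x ^+ 3) +
      2 * pi * c2 xi * x ^+ 2 + (2 * pi * c3 xi * y + t)).
      over.
    by rewrite /dot3 /ruled_cylinder /c1 /c2 /c3 /=; ring.
  apply: cubic_phase_le => //; rewrite !(normrM (2 * pi)) pi4.
  have := normr_ge0 (c1 xi); have := normr_ge0 (c2 xi).
  by case/orP: n4 => n4 c20 c10; apply/orP; [left|right]; nra.
right => x _.
under eq_Rintegral => y _.
  rewrite (_ : _ + t = 2 * pi * c3 xi * (y + 0 * y ^+ 3) + 0 * y ^+ 2 +
    (2 * pi * (c1 xi * x + c2 xi * x ^+ 2) + t)).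
    over.
  by rewrite /dot3 /ruled_cylinder /c1 /c2 /c3 /=; ring.
apply: cubic_phase_le => //; apply/orP; left; rewrite normrM pi4.
by have := normr_ge0 (c3 xi); nra.
Qed.

Lemma continuous_pt (f g h : R * R -> R) :
  continuous f -> continuous g -> continuous h ->
  continuous (fun z => pt (f z) (g z) (h z)).
Proof.
by move=> cf cg ch z; exact: (cvg_pair (cvg_pair (cf z) (cg z)) (ch z)).
Qed.

Lemma measurable_pt (f g h : R * R -> R) :
  measurable_fun setT f -> measurable_fun setT g -> measurable_fun setT h ->
  measurable_fun setT (fun z => pt (f z) (g z) (h z)).
Proof.
by move=> mf mg mh; apply: measurable_fun_pair => //; exact: measurable_fun_pair.
Qed.

Lemma exists_cone_decay e b (A : set R3) : 0 <= e <= 1 -> 0 < b <= 10^-1 ->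
  (forall x h, 0 <= x <= b -> A (ruled_cone e x h)) ->
  exists m : {measure set R3 -> \bar R}, MA A m /\
    exists C : R, forall xi, norm3 xi `^ (1 / 2) * ft_abs m xi <= C.
Proof.
move=> e01 b01 coneA; have /andP[b0 _] := b01.
have cfst : continuous (fst : R * R -> R) by move=> z; exact: cvg_fst.
have csnd : continuous (fun z : R * R => 1 + z.2).
  by move=> z; apply: cvgD; [exact: cvg_cst|exact: cvg_snd].
(* Heights in [[1, 1 + b]] avoid the apex, where the curve shrinks to a point. *)
apply: (@exists_measure_decay R b b0 (fun z => ruled_cone e z.1 (1 + z.2)) A 9).
- apply: continuous_pt => // z; apply: cvgM; first exact: csnd.
  + apply: cvgD; first exact: cfst.
    by apply: cvgM; [exact: cvg_cst|do 2 (apply: cvgM; first exact: cfst); exact: cfst].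
  + exact: csnd.
  + by apply: cvgM; exact: cfst.
- have m1 : measurable_fun setT (fst : R * R -> R) by exact: measurable_fst.
  have m2 : measurable_fun setT (fun z : R * R => 1 + z.2).
    by apply: measurable_funD => //; exact: measurable_snd.
  apply: measurable_pt => //; apply: measurable_funM => //.
  + apply: measurable_funD => //; apply: measurable_funM => //.
    exact: measurable_funX.
  + exact: measurable_funX.
- by move=> x y xb _; exact: coneA.
- by [].
- by move=> xi t n1; exact: cone_oscillation.
Qed.

Lemma exists_cylinder_decay : exists m : {measure set R3 -> \bar R},
  MA (@parabolic_cylinder R) m /\
    exists C : R, forall xi, norm3 xi `^ (1 / 2) * ft_abs m xi <= C.
Proof.
have b0 : 0 < 10^-1 :> R by lra.
have cfst : continuous (fst : R * R -> R) by move=> z; exact: cvg_fst.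
have csnd : continuous (snd : R * R -> R) by move=> z; exact: cvg_snd.
apply: (@exists_measure_decay R _ b0 (fun z => ruled_cylinder z.1 z.2) _ 9).
- by apply: continuous_pt => // z; apply: cvgM; exact: cfst.
- apply: measurable_pt; [exact: measurable_fst| |exact: measurable_snd].
  by apply: measurable_funX; exact: measurable_fst.
- by move=> x y _ _; exists x, y.
- by [].
- by move=> xi t n1; apply: cylinder_oscillation; rewrite ?b0 ?lexx.
Qed.

End surfaces.

Theorem mainTheorem7 (R : realType) :
  fourier_dim (@parabolic_cone R) = 1 /\
  (exists a b : R, a < 0 < b /\
     forall a' b' : R, a <= a' -> a' < 0 -> 0 < b' -> b' <= b ->
       fourier_dim (perturbed_cone a' b') = 1) /\
  fourier_dim (@parabolic_cylinder R) = 1.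
Proof.
have e0 : 0 <= (0 : R) <= 1 by rewrite lexx ler01.
have e1 : 0 <= (1 : R) <= 1 by rewrite lexx ler01.
split; [|split].
- apply: fourier_dim_eq1.
    move=> m s C; apply: (cone_exponent_le1 e0) => p [x [h ->]]; exists x, h.
    by rewrite /ruled_cone mul0r addr0.
  apply: (@exists_cone_decay _ 0 10^-1) => //; first lra.
  by move=> x h _; exists x, h; rewrite /ruled_cone mul0r addr0.
(* The upper bound concerns the full parameter line and the lower bound a short interval to the
   right of 0, so [(-1, 1)] is an arbitrary choice. *)
- exists (-1), 1; split; first lra.
  move=> a b _ a0 b0 _; apply: fourier_dim_eq1.
    move=> m s C; apply: (cone_exponent_le1 e1) => p [x [h [_ ->]]]; exists x, h.
    by rewrite /ruled_cone mul1r.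
  (* Halving [b] keeps the closed parameter interval inside the open one. *)
  apply: (@exists_cone_decay _ 1 (Num.min (b / 2) 10^-1)) => //.
    by rewrite lt_min ge_min lexx orbT andbT; lra.
  move=> x h; rewrite le_min => /and3P[x0 xb _]; exists x, h.
  by rewrite /ruled_cone mul1r; split => //; lra.
- apply: fourier_dim_eq1; last exact: exists_cylinder_decay.
  by move=> m s C; apply: cylinder_exponent_le1 => p [x [h ->]]; exists x, h.
Qed.
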